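(* Let $\nu\in P_+$ be a dominant weight and let $\mu\in P$ be any weight, written $\mu=\overline{\mu}+\mu^{\diamondsuit}$. Then $$K_{\nu,\mu}(p,q)=\sum_{\overline{\lambda}\in\overline{P}_{+}}b_{\nu,\overline{\lambda}+\mu^{\diamondsuit}}(p)\,\overline{K}_{\overline{\lambda},\overline{\mu}}(q)=\sum_{\overline{\lambda}\in\overline{P}_{+}}b_{\nu,\overline{\lambda}+\mu^{\diamondsuit}}(p)\,\overline{K}_{\overline{\lambda}+\mu^{\diamondsuit},\mu}(q),$$ where each $\overline{\lambda}+\mu^{\diamondsuit}$ belongs to $\overline{P}_+$.
   Context: $\mathfrak{g}$ is a finite-dimensional simple Lie algebra over $\mathbb{C}$ with Cartan subalgebra $\mathfrak{h}$, root system $R$ in a Euclidean space $E$ with scalar product $\langle\cdot,\cdot\rangle$, positive roots $R_+$, simple roots $\alpha_i$ ($i\in I$), fundamental weights $\omega_i$ ($i\in I$), Weyl group $W$ with sign character $\varepsilon$, weight lattice $P$, dominant weights $P_+=\bigoplus_{i\in I}\mathbb{N}\omega_i$, $Q_+=\sum_{\alpha\in R_+}\mathbb{N}\alpha$, $\rho=\frac12\sum_{\alpha\in R_+}\alpha=\sum_{i\in I}\omega_i$. Fix a subset $\overline{I}\subset I$. Let $\overline{R}$ be the parabolic root subsystem with simple roots $\alpha_i$, $i\in\overline I$, $\overline R_+=\overline R\cap R_+$, $\overline W=\langle s_i\mid i\in\overline I\rangle$, and $\overline P_+=\{\delta\in P\mid\langle\delta,\alpha_i\rangle\ge 0,\ i\in\overline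 I\}=\bigoplus_{i\in\overline I}\mathbb{N}\omega_i\oplus\bigoplus_{i\in I\setminus\overline I}\mathbb{Z}\omega_i$. Each $v\in E$ is written uniquely as $v=\overline v+v^{\diamondsuit}$ with $\overline v\in\bigoplus_{i\in\overline I}\mathbb{R}\omega_i$ and $v^{\diamondsuit}\in\bigoplus_{i\in I\setminus\overline I}\mathbb{R}\omega_i$. In particular $\overline\rho=\sum_{i\in\overline I}\omega_i$. Let $p,q$ be indeterminates. Partition functions are defined by $$\prod_{\alpha\in R_+\setminus\overline R_+}\frac1{1-pe^\alpha}\prod_{\alpha\in\overline R_+}\frac1{1-qe^\alpha}=\sum_{\beta}\mathrm P_{p,q}(\beta)e^\beta,\quad \prod_{\alpha\in R_+\setminus\overline R_+}\frac1{1-pe^\alpha}=\sum_{\eta}\hat{\mathrm P}_p(\eta)e^\eta,\quad \prod_{\alpha\in\overline R_+}\frac1{1-qe^\alpha}=\sum_{\delta}\overline{\mathrm P}_q(\delta)e^\delta,$$ and each is $0$ on weights not appearing in the expansion. For $\nu\in P_+$, $\mu\in P$, $\kappa\in P$ set $$K_{\nu,\mu}(p,q)=\sum_{w\in W}\varepsilon(w)\mathrm P_{p,q}(w(\nu+\rho)-\mu-\rho),\qquad b_{\nu,\kappa}(p)=\sum_{w\in W}\varepsilon(w)\hat{\mathrm P}_p(w(\nu+\rho)-\kappa-\rho),$$ and for $\kappa,\mu\in P$ set $$\overline K_{\kappa,\mu}(q)=\sum_{\overline w\in\overline W}\varepsilon(\overline w)\overline{\mathrm P}_q(\overline w(\kappa+\overline\rho)-\mu-\overline\rho).$$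 In the sums of the claim the symbol $\overline\lambda$ is a summation variable running over all of $\overline P_+$. *)

(* Defs.v *)
From HB Require Import structures.
From mathcomp Require Import all_boot all_order all_algebra.
From mathcomp Require Import complex.
From mathcomp Require Import boolp classical_sets functions cardinality fsbigop.
From mathcomp Require Import reals.

Set Implicit Arguments.
Unset Strict Implicit.
Unset Printing Implicit Defensive.

Import Order.TTheory GRing.Theory Num.Theory.

Local Open Scope classical_set_scope.
Local Open Scope ring_scope.

Section LieAlgebra.
Variable K : fieldType.

Record lieAlgebra := LieAlgebra {
  lie_space :> vectType K;
  lie_bracket : {bilinear lie_space -> lie_space -> lie_space};
  lie_bracketxx : forall x, lie_bracket x x = 0;
  lie_jacobi : forall x y z,
    lie_bracket x (lie_bracket y z) + lie_bracket y (lie_bracket z x)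
      + lie_bracket z (lie_bracket x y) = 0 }.

Variable g : lieAlgebra.
Local Notation br := (@lie_bracket g).

Definition lie_simple : Prop :=
  (exists x y, br x y != 0) /\
  (forall U : {vspace g}, (forall x u, u \in U -> br x u \in U) ->
     U = 0%VS \/ U = fullv).

Definition lie_prod (U V : {vspace g}) : {vspace g} :=
  <<[seq br u v | u <- vbasis U, v <- vbasis V]>>%VS.

(* A Cartan subalgebra is a nilpotent self-normalizing subalgebra. *)
Definition cartan_subalgebra (h : {vspace g}) : Prop :=
  [/\ (lie_prod h h <= h)%VS,
      exists n, iter n (lie_prod h) h = 0%VS
    & forall x, (forall y, y \in h -> br x y \in h) -> x \in h].

Definition lie_root (h : {vspace g}) (a : 'Hom(subvs_of h, K^o)) : Prop :=
  a != 0 /\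
  exists2 x : g, x != 0 & forall y : subvs_of h, br (vsval y) x = a y *: x.

End LieAlgebra.

Section RootSystem.
Variables (R : realType) (E : vectType R) (sp : {dot E for idfun}).

(* <v, a^vee> *)
Definition coroot_pairing (v a : E) : R := 2 * sp v a / sp a a.

Definition reflection (a : E) : 'End(E) :=
  linfun (fun v => v - coroot_pairing v a *: a).

Definition reflection_group (S : set E) : set 'End(E) :=
  [set w | exists2 s : seq E, (forall a, a \in s -> S a) &
           w = \big[@comp_lfun _ _ _ _ / \1%VF]_(a <- s) reflection a].

(* The determinant character, which is -1 on reflections. *)
Definition weyl_sign (A : pzRingType) (w : 'End(E)) : A :=
  (-1) ^+ (\det (passmx.mxof (vbasis fullv) (vbasis fullv) w) < 0)%R.

Record based_root_system := BasedRootSystem {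
  root_seq : seq E;
  roots_uniq : uniq root_seq;
  roots_span : <<root_seq>>%VS = fullv;
  roots_neq0 : 0 \notin root_seq;
  roots_reduced : forall a (t : R),
    a \in root_seq -> t *: a \in root_seq -> t = 1 \/ t = -1;
  roots_reflection : forall a b,
    a \in root_seq -> b \in root_seq -> reflection a b \in root_seq;
  roots_integral : forall a b,
    a \in root_seq -> b \in root_seq -> coroot_pairing b a \is a Num.int;
  simple_index : finType;
  sroot : simple_index -> E;
  sroot_root : forall i, sroot i \in root_seq;
  sroot_free : free [seq sroot i | i : simple_index];
  sroot_base : forall a, a \in root_seq ->
    exists c : simple_index -> nat,
      a = \sum_i sroot i *+ c i \/ a = - \sum_i sroot i *+ c i;
  fweight : simple_index -> E;
  fweight_sroot : forall i j,
    coroot_pairing (fweight i) (sroot j) = (i == j)%:R }.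

End RootSystem.

(* The root system of (g, h), regarded in the Euclidean space E: a real-linear *)
(* embedding of E into the dual of h identifies Phi with the roots of (g, h).  *)
Definition is_root_system_of (R : realType) (E : vectType R)
    (sp : {dot E for idfun}) (Phi : based_root_system sp)
    (g : lieAlgebra R[i]) (h : {vspace g}) : Prop :=
  exists f : E -> 'Hom(subvs_of h, R[i]^o),
    [/\ injective f,
        forall u v, f (u + v) = f u + f v,
        forall (t : R) v, f (t *: v) = (t%:C)%C *: f v
      & forall x, lie_root x <-> exists2 a, a \in root_seq Phi & f a = x].

(* A family f : E -> A stands for the formal sum \sum_b f b e^b.              *)
Section FormalSeries.
Variables (A : comNzRingType) (E : zmodType).

Definition fs_one : E -> A := fun b => (b == 0)%:R.

Definition fs_mul (f g : E -> A) : E -> A :=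
  fun b => \sum_(x \in [set: E]) f x * g (b - x).

(* 1 / (1 - c e^a) = \sum_k c^k e^(k a), for a != 0 *)
Definition fs_geom (c : A) (a : E) : E -> A :=
  fun b => \sum_(k \in [set k : nat | a *+ k = b]) c ^+ k.

Definition fs_geom_prod (c : A) (s : seq E) : E -> A :=
  \big[fs_mul/fs_one]_(a <- s) fs_geom c a.

End FormalSeries.

Section Parabolic.
Variables (R : realType) (E : vectType R) (sp : {dot E for idfun}).
Variable Phi : based_root_system sp.
Local Notation I := (simple_index Phi).
Local Notation alpha := (@sroot _ _ _ Phi).
Local Notation omega := (@fweight _ _ _ Phi).

Definition pos_roots : seq E :=
  [seq a <- root_seq Phi | `[< exists c : I -> nat, a = \sum_i alpha i *+ c i >]].

Definition weyl_group : set 'End(E) :=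
  reflection_group sp [set a | a \in root_seq Phi].

Definition weight_lattice : set E :=
  [set v | forall a, a \in root_seq Phi -> coroot_pairing sp v a \is a Num.int].

Definition dominant_weights : set E :=
  [set v | exists c : I -> nat, v = \sum_i omega i *+ c i].

Definition rho : E := 2^-1 *: \sum_(a <- pos_roots) a.

Variable J : {set I}.

Definition par_pos_roots : seq E :=
  [seq a <- pos_roots | a \in <<[seq alpha i | i in J]>>%VS].

Definition nonpar_pos_roots : seq E :=
  [seq a <- pos_roots | a \notin <<[seq alpha i | i in J]>>%VS].

Definition par_weyl_group : set 'End(E) :=
  reflection_group sp [set a | exists2 i, i \in J & a = alpha i].

Definition par_dominant_weights : set E :=
  [set v | weight_lattice v /\ forall i, i \in J -> 0 <= sp v (alpha i)].

Definition par_space : {vspace E} := <<[seq omega i | i in J]>>%VS.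
Definition copar_space : {vspace E} := <<[seq omega i | i in ~: J]>>%VS.

Definition bar_part (v : E) : E := daddv_pi par_space copar_space v.
Definition diamond_part (v : E) : E := daddv_pi copar_space par_space v.

Definition par_rho : E := bar_part rho.

Section Coefficients.
Variable A : comNzRingType.
Implicit Types p q : A.

Definition hatP p : E -> A := fs_geom_prod p nonpar_pos_roots.
Definition barP q : E -> A := fs_geom_prod q par_pos_roots.
Definition partP p q : E -> A := fs_mul (hatP p) (barP q).

Definition Kpq (nu mu : E) p q : A :=
  \sum_(w \in weyl_group)
     weyl_sign A w * partP p q (w (nu + rho) - mu - rho).

Definition b_coef (nu kappa : E) p : A :=
  \sum_(w \in weyl_group)
     weyl_sign A w * hatP p (w (nu + rho) - kappa - rho).

Definition Kbar (kappa mu : E) q : A :=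
  \sum_(w \in par_weyl_group)
     weyl_sign A w * barP q (w (kappa + par_rho) - mu - par_rho).

End Coefficients.
End Parabolic.

(* The two indeterminates of Z[p, q] = Z[p][q]. *)
Definition p_ind : {poly {poly int}} := 'X%:P.
Definition q_ind : {poly {poly int}} := 'X.

(* Main.v *)
Require Import Defs.
From HB Require Import structures.
From mathcomp Require Import all_boot all_order all_algebra.
From mathcomp Require Import complex.
From mathcomp Require Import boolp classical_sets functions cardinality fsbigop.
From mathcomp Require Import reals.
From mathcomp Require Import ring lra.

Import Order.TTheory GRing.Theory Num.Theory.
Local Open Scope classical_set_scope.
Local Open Scope ring_scope.

(** Write [w o kappa = w (kappa + rho) - rho] for the shifted action. The
    series of [partP] is the product of those of [hatP] and [barP], so
    expanding it in the definition of K and summing over the Weyl group first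
    gives
<<
      K_{nu,mu}(p,q) = \sum_kappa b_{nu,kappa}(p) barP_q(kappa - mu),
>>
    a sum with finitely many nonzero terms ([Kpq_b_coef_barP]).

    The positive roots outside the parabolic subsystem are permuted by the
    parabolic Weyl group W_J, hence [hatP] is W_J-invariant
    ([hatP_sreflection]), and reindexing the sum that defines b yields the skew
    symmetry b_{nu,u o kappa} = eps(u) b_{nu,kappa} for u in W_J
    ([b_coef_dot_act]). So b vanishes at every kappa such that kappa + rho lies
    on a wall of W_J ([b_coef_singular]), while any other weight kappa is u o
    lambda for exactly one pair of a J-dominant weight lambda and an element u
    of W_J ([par_weyl_dominant], [dot_act_inj]). Grouping the kappa by their
    lambda,
<<
      K_{nu,mu} = \sum_lambda b_{nu,lambda} \sum_u eps(u) barP_q(u o lambda - mu),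
>>
    and since rho and its J-part differ by a vector fixed by W_J, the inner sum
    is Kbar_{lambda,mu} ([Kpq_par_dominant_sum]).

    Finally the diamond part of mu is a weight fixed by W_J. Translation by it
    permutes the J-dominant weights, which gives the sum over lambda +
    mu^diamond, and it does not change Kbar when applied to both indices
    ([Kbar_shift]), which identifies the two sums of the theorem term by term.

    Two ingredients come from the general theory of root systems: that W_J acts
    freely on strictly J-dominant vectors ([par_weyl_free], through the
    exchange property of words in simple reflections), and that integrality on
    the simple coroots implies integrality on all coroots ([weight_simple]),
    which makes the diamond part of a weight a weight. *)

Set Implicit Arguments.
Unset Strict Implicit.
Unset Printing Implicit Defensive.

(** * Auxiliary facts on spans, finite sets and finitely supported sums *)

(** Properties of all the vectors of a span are proved through this induction,
    which avoids naming the coordinates. *)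
Lemma span_ind (K : fieldType) (V : vectType K) (X : seq V) (P : V -> Prop) :
  P 0 -> (forall u v, P u -> P v -> P (u + v)) ->
  (forall c u, P u -> P (c *: u)) -> (forall x, x \in X -> P x) ->
  forall v, v \in <<X>>%VS -> P v.
Proof.
move=> P0 PD PZ PX v vX; have tX := in_tupleE X.
rewrite -tX in vX; rewrite (coord_span vX).
by elim/big_ind: _ => // i _; apply/PZ/PX/mem_nth.
Qed.

Lemma span_image_ind (K : fieldType) (V : vectType K) (I : finType)
    (J : {set I}) (f : I -> V) (P : V -> Prop) :
  P 0 -> (forall u v, P u -> P v -> P (u + v)) ->
  (forall c u, P u -> P (c *: u)) -> (forall i, i \in J -> P (f i)) ->
  forall v, v \in <<[seq f i | i in J]>>%VS -> P v.
Proof.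
move=> P0 PD PZ PJ; apply: span_ind => // x /fintype.imageP[i iJ ->].
exact: PJ.
Qed.

Lemma perm_map_stable (T : eqType) (f : T -> T) (s : seq T) :
  injective f -> uniq s -> (forall x, x \in s -> f x \in s) ->
  perm_eq (map f s) s.
Proof.
move=> fi us fs; have ufs : uniq (map f s) by rewrite map_inj_uniq.
apply: uniq_perm => //.
have [|//|_ e] := uniq_min_size ufs (s2 := s); last exact: e.
  by move=> _ /mapP[x xs ->]; apply: fs.
by rewrite size_map.
Qed.

(** Used for the Weyl group, whose elements are determined by the way they
    permute the roots. *)
Lemma finite_set_inj (T : choiceType) (F : finType) (A : set T) (f : T -> F) :
  {in A &, injective f} -> finite_set A.
Proof.
move=> fA; have [[x0 _]|nA] := pselect (A !=set0); last first.
  suff -> : A = set0 by exact: finite_set0.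
  by rewrite -subset0 => x Ax; apply: nA; exists x.
pose g y := xget x0 [set x | A x /\ f x = y].
apply: (@sub_finite_set _ _ (g @` setT)); last exact/finite_image/finite_finset.
move=> x Ax; exists (f x) => //; rewrite /g.
case: xgetP => [z _ [Az fz]|/(_ x)[]//].
by apply: fA => //; rewrite inE.
Qed.

Lemma seq_argmax (R : realDomainType) (T : eqType) (f : T -> R) (s : seq T) x0 :
  x0 \in s -> exists2 x, x \in s & forall y, y \in s -> f y <= f x.
Proof.
elim: s x0 => // a s IHs x0 _.
have [->|[b bs]] : s = [::] \/ exists b, b \in s.
- by case: s {IHs} => [|b s]; [left | right; exists b; rewrite mem_head].
- by exists a => [|y]; rewrite inE // => /eqP ->.
have [x xs xmax] := IHs _ bs; have [le_xa|lt_ax] := leP (f x) (f a).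
  exists a; first exact: mem_head.
  move=> y; rewrite inE => /orP[/eqP -> //|/xmax fy]; exact: le_trans fy le_xa.
exists x; first by rewrite inE xs orbT.
by move=> y; rewrite inE => /orP[/eqP ->|/xmax//]; exact: ltW.
Qed.

Lemma fsum_neq0 (A : nmodType) (T : choiceType) (P : set T) (F : T -> A) :
  \sum_(i \in P) F i != 0 -> exists2 i, P i & F i != 0.
Proof.
apply: contra_neqP => nP; apply: fsbig1 => i Pi.
by apply/eqP; apply: contra_notT nP => Fi; exists i.
Qed.

(** * Reflections and their determinant *)

Section Reflections.
Variables (R : realType) (E : vectType R) (sp : {dot E for idfun}).
Local Notation s_ := (reflection sp).
Local Notation "<[ v | a ]>" := (coroot_pairing sp v a).

Lemma spC u v : sp u v = sp v u.
Proof. by rewrite (@hermC _ _ idfun _ sp u v) expr0 mul1r. Qed.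

Lemma sp_gt0 u : u != 0 -> 0 < sp u u.
Proof. exact: neq0_dnorm_gt0. Qed.

Lemma sp_ge0 u : 0 <= sp u u.
Proof. by have [->|/sp_gt0/ltW//] := eqVneq u 0; rewrite linear0r. Qed.

Lemma sp_eq0 u : sp u u = 0 -> u = 0.
Proof. by have [//|/sp_gt0] := eqVneq u 0; rewrite lt0r => /andP[/eqP]. Qed.

Lemma pairingD u v a : <[u + v | a]> = <[u | a]> + <[v | a]>.
Proof. by rewrite /coroot_pairing linearDl; ring. Qed.

Lemma pairingZ c u a : <[c *: u | a]> = c * <[u | a]>.
Proof. by rewrite /coroot_pairing linearZl_LR /=; ring. Qed.

Lemma pairingN u a : <[- u | a]> = - <[u | a]>.
Proof. by rewrite -scaleN1r pairingZ mulN1r. Qed.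

Lemma pairingB u v a : <[u - v | a]> = <[u | a]> - <[v | a]>.
Proof. by rewrite pairingD pairingN. Qed.

Lemma pairing0 a : <[0 | a]> = 0.
Proof. by rewrite -(scale0r 0) pairingZ mul0r. Qed.

Lemma pairing_sum (T : Type) (r : seq T) (F : T -> E) a :
  <[\sum_(i <- r) F i | a]> = \sum_(i <- r) <[F i | a]>.
Proof.
by apply: (big_morph (fun v => <[v | a]>)) => [u v|];
  [exact: pairingD | exact: pairing0].
Qed.

Lemma pairing_self a : a != 0 -> <[a | a]> = 2.
Proof. by move=> /sp_gt0 a0; rewrite /coroot_pairing mulfK // gt_eqF. Qed.

Lemma pairingNr v a : <[v | - a]> = - <[v | a]>.
Proof.
by rewrite /coroot_pairing linearNr linearNl linearNr opprK mulrN mulNr.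
Qed.

Lemma reflectionE a v : s_ a v = v - <[v | a]> *: a.
Proof.
have lin : linear (fun v => v - <[v | a]> *: a).
  by move=> c u w; rewrite pairingD pairingZ scalerDl scalerBr scalerA opprD
    addrACA.
pose f := GRing.isSemilinear.Build R E E *:%R _ (GRing.semilinear_linear lin).
pose F : {linear E -> E} := HB.pack (fun v => v - <[v | a]> *: a) f.
exact: (lfunE F v).
Qed.

Lemma reflection_self a : a != 0 -> s_ a a = - a.
Proof.
by move=> a0; rewrite reflectionE pairing_self// scaler_nat mulr2n opprD addrA
  subrr sub0r.
Qed.

Lemma reflectionK a : a != 0 -> involutive (s_ a).
Proof.
move=> a0 v; rewrite [s_ a v]reflectionE linearB linearZ /= reflection_self//.
by rewrite reflectionE scalerN opprK subrK.
Qed.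

Lemma sp_reflection a u v : a != 0 -> sp (s_ a u) (s_ a v) = sp u v.
Proof.
move=> /sp_gt0 a0; rewrite !reflectionE linearBl !linearBr linearZl_LR
  linearZr_LR /=.
rewrite linearZl_LR linearZr_LR /= /coroot_pairing (spC a v).
by field; rewrite gt_eqF.
Qed.

Lemma pairing_reflection a u v : a != 0 -> <[s_ a u | s_ a v]> = <[u | v]>.
Proof. by move=> a0; rewrite /coroot_pairing !sp_reflection. Qed.

Lemma sp_pairing v a : a != 0 -> sp v a = <[v | a]> * (sp a a / 2).
Proof.
by move=> /sp_gt0 a0; rewrite /coroot_pairing; field; rewrite gt_eqF.
Qed.

(** The matrix determinant lemma. The block matrix [B] becomes block triangular
    by a row operation and also by a column operation of determinant 1, and
    comparing the two values of its determinant gives the formula. *)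
Lemma det_1sub_rank1 n (c : 'cV[R]_n) (r : 'rV[R]_n) :
  \det (1%:M - c *m r) = 1 - (r *m c) 0 0.
Proof.
pose B : 'M_(n + 1) := block_mx 1%:M c r 1%:M.
have e1 : block_mx 1%:M 0 (- r) 1%:M *m B = block_mx 1%:M c 0 (1%:M - r *m c).
  rewrite mulmx_block !mul1mx !mul0mx !addr0 mulmx1 addNr mulNmx addrC //.
have e2 : B *m block_mx 1%:M 0 (- r) 1%:M = block_mx (1%:M - c *m r) c 0 1%:M.
  by rewrite mulmx_block !mulmx1 !mulmx0 !mul1mx mulmxN add0r addrN add0r.
have := congr1 determinant e1; have := congr1 determinant e2.
rewrite !det_mulmx !det_ublock !det_lblock !det1 !mulr1 !mul1r => <- ->.
by rewrite det_mx11 !mxE eqxx.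
Qed.

(** A reflection is the identity minus the rank one map v |-> <v, a^vee> a,
    whose trace is <a, a^vee> = 2; so its determinant is 1 - 2. *)
Lemma det_reflection a : a != 0 ->
  \det (passmx.mxof (vbasis fullv) (vbasis fullv) (s_ a)) = -1.
Proof.
move=> a0; have eb := vbasisP {:E}; set e := vbasis _ in eb *.
rewrite (_ : passmx.mxof e e (s_ a) =
  1%:M - (\col_i <[e`_i | a]>) *m passmx.rVof e a).
  rewrite det_1sub_rank1 -[X in 1 - X]/(_ 0 0) (_ : (_ *m _) 0 0 = 2) //;
    first by ring.
  rewrite -[RHS](pairing_self a0) [X in <[X | _]>](coord_basis eb (memvf a)).
  rewrite pairing_sum mxE; apply: eq_bigr => i _; rewrite !mxE.
  by rewrite pairingZ.
apply/matrixP => i j; rewrite !mxE /= passmx.vecof_delta reflectionE.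
rewrite linearB linearZ /= coord_free ?(basis_free eb)// big_ord1 !mxE.
by [].
Qed.

Section Sign.
Variable A : pzRingType.

Lemma mxof_comp_end (u v : 'End(E)) (e := vbasis {:E}) :
  passmx.mxof e e (u \o v)%VF = passmx.mxof e e v *m passmx.mxof e e u.
Proof. exact/passmx.mxof_comp/vbasisP. Qed.

Lemma weyl_sign1 : weyl_sign A (\1%VF : 'End(E)) = 1.
Proof.
by rewrite /weyl_sign passmx.mxof1 ?det1 ?ltr10 ?(basis_free (vbasisP _)).
Qed.

(** The sign is read off the sign of a real determinant, so it is multiplicative
    only at invertible maps: hence the hypothesis on [w]. *)
Lemma weyl_sign_reflectionl a (w : 'End(E)) : a != 0 ->
  \det (passmx.mxof (vbasis {:E}) (vbasis {:E}) w) != 0 ->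
  weyl_sign A (s_ a \o w)%VF = - weyl_sign A w.
Proof.
move=> a0 w0; rewrite /weyl_sign mxof_comp_end det_mulmx det_reflection//.
rewrite mulrN1 oppr_lt0; case: ltrgtP w0 => //= _ _.
  by rewrite expr0 expr1 opprK.
Qed.
End Sign.

End Reflections.

(** * Simple roots, fundamental weights and weights of a root system *)

Section RootSystemTheory.
Variables (R : realType) (E : vectType R) (sp : {dot E for idfun}).
Variable Phi : based_root_system sp.
Local Notation s_ := (reflection sp).
Local Notation "<[ v | a ]>" := (coroot_pairing sp v a).
Local Notation I := (simple_index Phi).
Local Notation alpha := (@sroot _ _ _ Phi).
Local Notation omega := (@fweight _ _ _ Phi).

Lemma root_neq0 a : a \in root_seq Phi -> a != 0.
Proof. by apply: contraTneq => ->; exact: roots_neq0. Qed.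

Lemma sroot_neq0 i : alpha i != 0.
Proof. exact/root_neq0/sroot_root. Qed.
Hint Resolve sroot_neq0 : core.

Lemma root_opp a : a \in root_seq Phi -> - a \in root_seq Phi.
Proof.
by move=> aR; rewrite -(reflection_self sp (root_neq0 aR));
  apply: roots_reflection.
Qed.

(** By orthogonality of simple roots and fundamental weights, pairing with the
    j-th fundamental weight computes the coordinate on the j-th simple root. *)
Definition root_coord (j : I) (v : E) : R :=
  2 * sp v (omega j) / sp (alpha j) (alpha j).

Lemma root_coordD j u v :
  root_coord j (u + v) = root_coord j u + root_coord j v.
Proof. by rewrite /root_coord linearDl; ring. Qed.

Lemma root_coordZ j c v : root_coord j (c *: v) = c * root_coord j v.
Proof. by rewrite /root_coord linearZl_LR /=; ring. Qed.

Lemma root_coordN j v : root_coord j (- v) = - root_coord j v.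
Proof. by rewrite -scaleN1r root_coordZ mulN1r. Qed.

Lemma root_coordB j u v :
  root_coord j (u - v) = root_coord j u - root_coord j v.
Proof. by rewrite root_coordD root_coordN. Qed.

Lemma root_coord0 j : root_coord j 0 = 0.
Proof. by rewrite -(scale0r 0) root_coordZ mul0r. Qed.

Lemma root_coord_sroot i j : root_coord j (alpha i) = (i == j)%:R.
Proof.
have := fweight_sroot j i;
  rewrite /coroot_pairing /root_coord spC [j == i]eq_sym.
case: eqVneq => [->//|_] /eqP.
rewrite !mulf_eq0 invr_eq0 pnatr_eq0 /= => /orP[/eqP->|];
  first by rewrite mulr0 mul0r.
by rewrite gt_eqF // sp_gt0.
Qed.

Lemma root_coord_sum j (c : I -> R) :
  root_coord j (\sum_i c i *: alpha i) = c j.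
Proof.
rewrite (big_morph _ (root_coordD j) (root_coord0 j)) (bigD1 j) //=.
rewrite root_coordZ root_coord_sroot eqxx mulr1 big1 ?addr0 // => i /negPf ij.
by rewrite root_coordZ root_coord_sroot ij mulr0.
Qed.

Lemma root_coord_nat j (c : I -> nat) :
  root_coord j (\sum_i alpha i *+ c i) = (c j)%:R.
Proof. by under eq_bigr do rewrite -scaler_nat; rewrite root_coord_sum. Qed.

Lemma root_coordE v : v = \sum_i root_coord i v *: alpha i.
Proof.
have : v \in <<root_seq Phi>>%VS by rewrite roots_span memvf.
elim/span_ind: v / => [|u v eu ev|c u eu|a aR].
- by rewrite big1 // => i _; rewrite root_coord0 scale0r.
- rewrite {1}eu {1}ev -big_split; apply: eq_bigr => i _.
  by rewrite root_coordD scalerDl.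
- rewrite {1}eu scaler_sumr; apply: eq_bigr => i _.
  by rewrite root_coordZ scalerA.
- have [c [->|->]] := sroot_base aR.
    by apply: eq_bigr => i _; rewrite root_coord_nat scaler_nat.
  rewrite -sumrN; apply: eq_bigr => i _.
  by rewrite sumrN root_coordN root_coord_nat scaleNr scaler_nat.
Qed.

Lemma pairing_eq0 v : (forall i, <[v | alpha i]> = 0) -> v = 0.
Proof.
move=> v0; apply: (sp_eq0 (sp := sp)).
rewrite [X in sp _ X]root_coordE linear_sumr big1 // => i _.
by rewrite linearZr_LR /= sp_pairing // v0 mul0r mulr0.
Qed.

Lemma pairing_sum_fweight (c : I -> R) j :
  <[\sum_i c i *: omega i | alpha j]> = c j.
Proof.
rewrite pairing_sum (bigD1 j) //= pairingZ fweight_sroot eqxx mulr1.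
by rewrite big1 ?addr0 // => i /negPf ij;
  rewrite pairingZ fweight_sroot ij mulr0.
Qed.

Lemma pairing_fweightE v : v = \sum_i <[v | alpha i]> *: omega i.
Proof.
apply/eqP; rewrite -subr_eq0; apply/eqP/pairing_eq0 => j.
by rewrite pairingB pairing_sum_fweight subrr.
Qed.

Lemma root_coord_reflection i j v : i != j ->
  root_coord j (s_ (alpha i) v) = root_coord j v.
Proof.
move=> /negPf ij; rewrite reflectionE root_coordB root_coordZ root_coord_sroot.
by rewrite ij mulr0 subr0.
Qed.

Lemma pos_root_root a : a \in pos_roots Phi -> a \in root_seq Phi.
Proof. by rewrite mem_filter => /andP[]. Qed.

Lemma pos_root_sum a : a \in pos_roots Phi ->
  exists c : I -> nat, a = \sum_i alpha i *+ c i.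
Proof. by rewrite mem_filter => /andP[/asboolP]. Qed.

Lemma pos_root_coord_ge0 i a : a \in pos_roots Phi -> 0 <= root_coord i a.
Proof. by move=> /pos_root_sum[c ->]; rewrite root_coord_nat. Qed.

Lemma pos_rootVopp a : a \in root_seq Phi ->
  a \in pos_roots Phi \/ - a \in pos_roots Phi.
Proof.
move=> aR; have [c ec] := sroot_base aR.
rewrite !mem_filter aR root_opp // !andbT.
by case: ec => ->; [left|right]; apply/asboolP; exists c; rewrite ?opprK.
Qed.

Lemma pos_root_coord_gt0 i a :
  a \in root_seq Phi -> 0 < root_coord i a -> a \in pos_roots Phi.
Proof.
move=> aR ai; have [//|/(pos_root_coord_ge0 i)] := pos_rootVopp aR.
by rewrite root_coordN oppr_ge0 leNgt ai.
Qed.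

Lemma sroot_pos i : alpha i \in pos_roots Phi.
Proof.
by apply: (@pos_root_coord_gt0 i); rewrite ?sroot_root ?root_coord_sroot ?eqxx.
Qed.

Lemma pos_rootN a : a \in pos_roots Phi -> - a \notin pos_roots Phi.
Proof.
move=> ap; apply/negP => an; suff a0 : a = 0.
  by have := root_neq0 (pos_root_root ap); rewrite a0 eqxx.
rewrite [a]root_coordE big1 // => i _;
  suff -> : root_coord i a = 0 by rewrite scale0r.
apply/eqP; rewrite eq_le (pos_root_coord_ge0 i ap).
by have := pos_root_coord_ge0 i an; rewrite root_coordN oppr_ge0 => ->.
Qed.

(** Otherwise the root would be proportional to the simple root [alpha i]; but
    in a reduced root system the only other multiple of [alpha i] is its
    opposite, which is not positive. *)
Lemma pos_root_coord_neq i a : a \in pos_roots Phi -> a != alpha i ->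
  exists2 j, j != i & 0 < root_coord j a.
Proof.
move=> ap ai; apply: contrapT => nj.
have aE : a = root_coord i a *: alpha i.
  rewrite {1}[a]root_coordE (bigD1 i) //= big1 ?addr0 // => j ji.
  suff -> : root_coord j a = 0 by rewrite scale0r.
  apply/eqP; rewrite eq_le pos_root_coord_ge0 // andbT leNgt; apply/negP => aj.
  by apply: nj; exists j.
have [||ci|ci] := @roots_reduced _ _ _ Phi (alpha i) (root_coord i a).
- exact: sroot_root.
- by rewrite -aE pos_root_root.
- by move: ai; rewrite aE ci scale1r eqxx.
- by have := pos_root_coord_ge0 i ap; rewrite ci ler0N1.
Qed.

(** A simple reflection changes only one coordinate, so another coordinate of
    the root stays positive, and one positive coordinate forces a root to be
    positive. *)
Lemma sreflection_pos i a : a \in pos_roots Phi -> a != alpha i ->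
  s_ (alpha i) a \in pos_roots Phi.
Proof.
move=> ap /(pos_root_coord_neq ap)[j ji aj]; apply: (@pos_root_coord_gt0 j).
  by apply: roots_reflection; rewrite ?sroot_root ?pos_root_root.
by rewrite root_coord_reflection // eq_sym.
Qed.

Lemma pos_roots_uniq : uniq (pos_roots Phi).
Proof. exact/filter_uniq/roots_uniq. Qed.

Lemma reflection_inj a : a != 0 -> injective (s_ a).
Proof. by move=> /(reflectionK sp)/inv_inj. Qed.

(** The reflection in [alpha i] permutes the positive roots other than [alpha i]
    and negates [alpha i], so it removes exactly [alpha i] from their half
    sum. *)
Lemma sreflection_rho i : s_ (alpha i) (rho Phi) = rho Phi - alpha i.
Proof.
have perm_rem := perm_to_rem (sroot_pos i); set ps := rem _ _ in perm_rem.
have mem_ps a : (a \in ps) = (a != alpha i) && (a \in pos_roots Phi).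
  by rewrite (mem_rem_uniq _ pos_roots_uniq) inE.
have eS : \sum_(a <- ps) s_ (alpha i) a = \sum_(a <- ps) a.
  rewrite -(big_map (s_ (alpha i)) xpredT id); apply/perm_big/perm_map_stable.
  - exact: reflection_inj.
  - exact/rem_uniq/pos_roots_uniq.
  move=> a; rewrite !mem_ps => /andP[ai ap]; rewrite sreflection_pos // andbT.
  apply: contra (pos_rootN (sroot_pos i)) => /eqP sa.
  by rewrite -(reflection_self sp (sroot_neq0 i)) -[X in s_ _ X]sa reflectionK.
rewrite /rho (perm_big _ perm_rem) big_cons linearZ linearD linear_sum /=.
rewrite eS reflection_self // !scalerDr scalerN.
(* In the half sum rho the root alpha i itself occurs with coefficient 1/2. *)
have half : alpha i = 2^-1 *: alpha i + 2^-1 *: alpha i.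
  by rewrite -scalerDl (_ : _ + _ = 1) ?scale1r //; field.
by rewrite [X in _ - X]half opprD addrACA subrr add0r addrC.
Qed.

Lemma pairing_rho i : <[rho Phi | alpha i]> = 1.
Proof.
have := sreflection_rho i; rewrite reflectionE => /addrI/oppr_inj/eqP.
by rewrite -subr_eq0 -[X in _ - X]scale1r -scalerBl scaler_eq0
  (negPf (sroot_neq0 i)) orbF subr_eq0 => /eqP.
Qed.

Local Notation wt := (weight_lattice Phi).

Lemma weightD u v : wt u -> wt v -> wt (u + v).
Proof. by move=> uP vP a aR; rewrite pairingD rpredD ?uP ?vP. Qed.

Lemma weightN u : wt u -> wt (- u).
Proof. by move=> uP a aR; rewrite pairingN rpredN uP. Qed.

Lemma weightB u v : wt u -> wt v -> wt (u - v).
Proof. by move=> uP vP; apply/weightD/weightN. Qed.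

Lemma weight_sroot i : wt (alpha i).
Proof. by move=> a aR; apply: roots_integral aR (sroot_root _). Qed.

Lemma weight_reflection a v : a \in root_seq Phi -> wt v -> wt (s_ a v).
Proof.
move=> aR vP b bR; have a0 := root_neq0 aR.
by rewrite -[b](reflectionK sp a0) pairing_reflection // vP ?roots_reflection.
Qed.

(** If all these pairings were nonpositive, then so would be the squared length
    of the root, which is a nonnegative combination of them. *)
Lemma pairing_pos_gt0 a : a \in pos_roots Phi -> exists j, 0 < <[a | alpha j]>.
Proof.
move=> ap; apply: contrapT => nj.
have := sp_gt0 sp (root_neq0 (pos_root_root ap)).
rewrite [X in sp _ X]root_coordE linear_sumr ltNge => /negP; apply.
apply: sumr_le0 => j _; rewrite linearZr_LR /=.
rewrite mulr_ge0_le0 ?pos_root_coord_ge0 // sp_pairing // mulr_le0_ge0 //.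
  by rewrite leNgt; apply/negP => aj; apply: nj; exists j.
by rewrite divr_ge0 ?sp_ge0.
Qed.

(** By induction on the height of a positive root [a]. If [a] is not simple,
    some simple reflection maps it to a lower positive root; as reflections are
    isometries, the pairing of [v] with [a] is that of the reflected vector with
    the reflected root, and the reflected vector still has integral pairings
    with the simple coroots because those of the simple roots are integral. *)
Lemma weight_simple v : (forall i, <[v | alpha i]> \is a Num.int) -> wt v.
Proof.
suff pos n a : a \in pos_roots Phi -> \sum_i root_coord i a < n%:R ->
    forall v, (forall i, <[v | alpha i]> \is a Num.int) ->
      <[v | a]> \is a Num.int.
  move=> vP a aR.
  have arch b : b \in pos_roots Phi -> <[v | b]> \is a Num.int.
    move=> bp; apply: (pos (Num.truncn (\sum_i root_coord i b)).+1) => //.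
    exact: truncnS_gt.
  have [/arch//|/arch] := pos_rootVopp aR.
  by rewrite pairingNr rpredN.
elim: n a => [|n IHn] a ap; first by rewrite ltNge sumr_ge0 // => i _;
  exact: pos_root_coord_ge0.
move=> ha {}v vP.
have [j aj] := pairing_pos_gt0 ap.
have [->//|aNj] := eqVneq a (alpha j).
rewrite -(pairing_reflection sp v a (sroot_neq0 j)); apply: IHn.
- exact: sreflection_pos.
- rewrite (eq_bigr (fun i => root_coord i a - <[a | alpha j]> * (j == i)%:R));
  last first.
    by move=> i _; rewrite reflectionE root_coordB root_coordZ root_coord_sroot.
  have -> : \sum_i (root_coord i a - <[a | alpha j]> * (j == i)%:R)
      = \sum_i root_coord i a - <[a | alpha j]>.
    rewrite sumrB -mulr_sumr; congr (_ - _); rewrite (bigD1 j) //= eqxx big1.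
      by rewrite addr0 mulr1.
    by move=> i /negPf; rewrite eq_sym => ->.
  have : <[a | alpha j]> \is a Num.int.
    exact: roots_integral (sroot_root _) (pos_root_root ap).
  move=> /intrP[k ek]; move: ha aj; rewrite ek ltr0z -natr1 => ha k0.
  by have : (1 : R) <= k%:~R; [rewrite ler1z -gtz0_ge1 | lra].
- move=> i; rewrite reflectionE pairingB pairingZ;
  apply: rpredB (vP i) (rpredM (vP j) _).
  exact: roots_integral (sroot_root _) (sroot_root _).
Qed.

Section Parabolic.
Variable J : {set I}.

Lemma span_sroot_coord0 v j : v \in <<[seq alpha i | i in J] >>%VS ->
  j \notin J -> root_coord j v = 0.
Proof.
move=> vJ jJ; move: v vJ; apply: span_image_ind => [|u v eu ev|c u eu|i iJ].
- exact: root_coord0.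
- by rewrite root_coordD eu ev addr0.
- by rewrite root_coordZ eu mulr0.
- by rewrite root_coord_sroot; case: eqVneq iJ jJ => // -> ->.
Qed.

Lemma span_srootP v : (forall j, j \notin J -> root_coord j v = 0) ->
  v \in <<[seq alpha i | i in J] >>%VS.
Proof.
move=> vJ; rewrite [v]root_coordE memv_suml // => i _.
have [iJ|/vJ ->] := boolP (i \in J); last by rewrite scale0r mem0v.
by apply/memvZ/memv_span/fintype.imageP; exists i.
Qed.

Lemma nonpar_pos_rootP a : a \in nonpar_pos_roots J <->
  a \in root_seq Phi /\ exists2 j, j \notin J & 0 < root_coord j a.
Proof.
rewrite mem_filter; split=> [/andP[aJ ap]|[aR [j jJ aj]]].
  split; first exact: pos_root_root.
  apply: contrapT => nj; move/negP: aJ; apply; apply: span_srootP => j jJ.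
  apply/eqP; rewrite eq_le pos_root_coord_ge0 // andbT leNgt; apply/negP => aj.
  by apply: nj; exists j.
rewrite (pos_root_coord_gt0 aR aj) andbT;
  apply/negP => /span_sroot_coord0/(_ jJ) a0.
by rewrite a0 ltxx in aj.
Qed.

(** A positive root outside the parabolic subsystem has a positive coordinate
    outside [J], and the simple reflections indexed by [J] do not change that
    coordinate. *)
Lemma sreflection_nonpar i a : i \in J ->
  a \in nonpar_pos_roots J -> s_ (alpha i) a \in nonpar_pos_roots J.
Proof.
move=> iJ /nonpar_pos_rootP[aR [j jJ aj]]; apply/nonpar_pos_rootP; split.
  by rewrite roots_reflection ?sroot_root.
exists j => //; rewrite root_coord_reflection //.
by apply: contraNneq jJ => <-.
Qed.

Lemma par_space_pairing v j : v \in par_space J -> j \notin J ->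
  <[v | alpha j]> = 0.
Proof.
move=> vJ jJ; move: v vJ; apply: span_image_ind => [|u v eu ev|c u eu|i iJ].
- exact: pairing0.
- by rewrite pairingD eu ev addr0.
- by rewrite pairingZ eu mulr0.
- by rewrite fweight_sroot; case: eqVneq iJ jJ => // -> ->.
Qed.

Lemma copar_space_pairing v j : v \in copar_space J -> j \in J ->
  <[v | alpha j]> = 0.
Proof.
move=> vJ jJ; move: v vJ; apply: span_image_ind => [|u v eu ev|c u eu|i iJ].
- exact: pairing0.
- by rewrite pairingD eu ev addr0.
- by rewrite pairingZ eu mulr0.
- by rewrite fweight_sroot; case: eqVneq iJ => // ->; rewrite inE jJ.
Qed.

(** The fundamental weights form a basis, so the spaces spanned by those indexed
    by [J] and by its complement are complementary. *)
Lemma bar_diamondD v : bar_part J v + diamond_part J v = v.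
Proof.
apply: daddv_pi_add.
  apply/eqP; rewrite -subv0; apply/subvP => u;
    rewrite memv_cap memv0 => /andP[uJ uCJ].
  apply/eqP/pairing_eq0 => i; have [iJ|iJ] := boolP (i \in J).
    exact: copar_space_pairing.
  exact: par_space_pairing.
rewrite [v]pairing_fweightE memv_suml // => i _; apply: memvZ.
have [iJ|iJ] := boolP (i \in J).
  by apply/(subvP (addvSl _ _))/memv_span/fintype.imageP; exists i.
by apply/(subvP (addvSr _ _))/memv_span/fintype.imageP; exists i; rewrite ?inE.
Qed.

Lemma pairing_diamond v j : j \in J -> <[diamond_part J v | alpha j]> = 0.
Proof. by apply: copar_space_pairing; apply: memv_pi. Qed.

Lemma weight_diamond v : wt v -> wt (diamond_part J v).
Proof.
move=> vP; apply: weight_simple => i.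
have [iJ|iJ] := boolP (i \in J); first by rewrite pairing_diamond.
rewrite -[X in <[X | _]>](addKr (bar_part J v)) bar_diamondD pairingD pairingN.
rewrite (par_space_pairing _ iJ) ?memv_pi // oppr0 add0r vP //.
exact: sroot_root.
Qed.

Lemma par_dominantP v : par_dominant_weights J v <->
  wt v /\ forall i, i \in J -> 0 <= <[v | alpha i]>.
Proof.
have eq_ge0 i : (0 <= sp v (alpha i)) = (0 <= <[v | alpha i]>).
  by rewrite sp_pairing // pmulr_lge0 // divr_gt0 ?ltr0n // sp_gt0.
by split=> -[vP vJ]; split=> // i iJ; have := vJ i iJ; rewrite eq_ge0.
Qed.

Lemma par_dominant_diamond v lam : wt v ->
  par_dominant_weights J lam -> par_dominant_weights J (lam + diamond_part J v).
Proof.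
move=> vP /par_dominantP[lP lJ]; apply/par_dominantP; split.
  exact/weightD/weight_diamond.
by move=> i iJ; rewrite pairingD pairing_diamond // addr0 lJ.
Qed.
End Parabolic.
End RootSystemTheory.

(** * Weyl groups and their parabolic subgroups *)

Section ReflectionGroups.
Variables (R : realType) (E : vectType R) (sp : {dot E for idfun}).
Local Notation s_ := (reflection sp).

Variable S : set E.
Hypothesis S_neq0 : forall a, S a -> a != 0.
Local Notation W := (reflection_group sp S).

Lemma reflection_group1 : W \1%VF.
Proof. by exists [::] => //; rewrite big_nil. Qed.

Lemma reflection_groupMl a w : S a -> W w -> W (s_ a \o w)%VF.
Proof.
move=> Sa [s sS ->]; exists (a :: s); last by rewrite big_cons.
by move=> b; rewrite inE => /orP[/eqP -> //|/sS].
Qed.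

Lemma reflection_group_ind (P : 'End(E) -> Prop) :
  P \1%VF -> (forall a w, S a -> W w -> P w -> P (s_ a \o w)%VF) ->
  forall w, W w -> P w.
Proof.
move=> P1 PM w [s sS ->{w}]; elim: s sS => [|a s IHs] sS.
  by rewrite big_nil.
have sS' b : b \in s -> S b by move=> bs; apply: sS; rewrite inE bs orbT.
rewrite big_cons; apply: PM; last exact: IHs.
- by apply: sS; rewrite mem_head.
- by exists s.
Qed.

Lemma reflection_groupM u w : W u -> W w -> W (u \o w)%VF.
Proof.
move=> Wu Ww; elim/reflection_group_ind: u / Wu => [|a u Sa _ IHu].
  by rewrite comp_lfun1l.
by rewrite -comp_lfunA; apply: reflection_groupMl.
Qed.

Lemma reflection_comp_id a : a != 0 -> (s_ a \o s_ a = \1)%VF.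
Proof. by move=> a0; apply/lfunP => v; rewrite !lfunE /= reflectionK. Qed.

Lemma reflection_group_inv w : W w ->
  exists2 w', W w' & (w' \o w = \1)%VF /\ (w \o w' = \1)%VF.
Proof.
move=> Ww; elim/reflection_group_ind: w / Ww => [|a w Sa _ [w' Ww' [w'w ww']]].
  by exists \1%VF; rewrite ?comp_lfun1l //; exact: reflection_group1.
have s2 := reflection_comp_id (S_neq0 Sa).
exists (w' \o s_ a)%VF.
  apply: reflection_groupM => //; rewrite -[s_ a]comp_lfun1r.
  exact: reflection_groupMl reflection_group1.
split; first by rewrite -comp_lfunA [(s_ a \o (s_ a \o _))%VF]comp_lfunA s2
  comp_lfun1l.
by rewrite -comp_lfunA [(w \o (w' \o _))%VF]comp_lfunA ww' comp_lfun1l.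
Qed.

Lemma reflection_group_isometry w u v : W w -> sp (w u) (w v) = sp u v.
Proof.
move=> Ww; elim/reflection_group_ind: w / Ww => [|a w Sa _ IHw].
  by rewrite !lfunE.
by rewrite !comp_lfunE sp_reflection ?IHw // S_neq0.
Qed.

(** An isometry conjugates the reflection in [a] into the reflection in its
    image. *)
Lemma comp_reflection w a : W w -> (w \o s_ a = s_ (w a) \o w)%VF.
Proof.
move=> Ww; apply/lfunP => v;
  rewrite !comp_lfunE !reflectionE linearB linearZ /=.
by rewrite /coroot_pairing !reflection_group_isometry.
Qed.

Lemma det_reflection_group_neq0 w : W w ->
  \det (passmx.mxof (vbasis {:E}) (vbasis {:E}) w) != 0.
Proof.
move=> Ww; elim/reflection_group_ind: w / Ww => [|a w Sa _ IHw].
  by rewrite passmx.mxof1 ?det1 ?oner_neq0 ?(basis_free (vbasisP _)).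
by rewrite mxof_comp_end det_mulmx det_reflection ?S_neq0 // mulrN1 oppr_eq0.
Qed.

Lemma weyl_signMl (A : pzRingType) a w : S a -> W w ->
  weyl_sign A (s_ a \o w)%VF = - weyl_sign A w.
Proof.
by move=> Sa Ww; rewrite weyl_sign_reflectionl ?det_reflection_group_neq0
  ?S_neq0.
Qed.

End ReflectionGroups.

Section WeylGroups.
Variables (R : realType) (E : vectType R) (sp : {dot E for idfun}).
Variable Phi : based_root_system sp.
Local Notation s_ := (reflection sp).
Local Notation "<[ v | a ]>" := (coroot_pairing sp v a).
Local Notation I := (simple_index Phi).
Local Notation alpha := (@sroot _ _ _ Phi).
Local Notation W := (weyl_group Phi).
Local Notation wt := (weight_lattice Phi).

Lemma weyl_group_root w a : W w -> a \in root_seq Phi -> w a \in root_seq Phi.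
Proof.
move=> Ww aR; elim/reflection_group_ind: w / Ww => [|b w bR _ IHw].
  by rewrite lfunE.
by rewrite comp_lfunE roots_reflection.
Qed.

Lemma weyl_group_weight w v : W w -> wt v -> wt (w v).
Proof.
move=> Ww vP; elim/reflection_group_ind: w / Ww => [|b w bR _ IHw].
  by rewrite lfunE.
by rewrite comp_lfunE; apply: weight_reflection.
Qed.

(** The roots are permuted by the Weyl group and span the space, so an element
    is determined by its action on the finite set of roots. *)
Lemma finite_weyl_group : finite_set W.
Proof.
pose n := size (root_seq Phi).
(* The bound n.+1 leaves room for the index n of a vector that is not a root. *)
pose f w : {ffun 'I_n -> 'I_n.+1} :=
  [ffun k : 'I_n => inord (index (w (root_seq Phi)`_k) (root_seq Phi))].
apply: (@finite_set_inj _ _ W f) => u v; rewrite !inE => Wu Wv /ffunP fuv.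
apply/lfunP => x; have : x \in <<root_seq Phi>>%VS by rewrite roots_span memvf.
elim/span_ind: x / => [|x y ex ey|c x ex|a aR].
- by rewrite !linear0.
- by rewrite !linearD /= ex ey.
- by rewrite !linearZ /= ex.
have ka : (index a (root_seq Phi) < n)%N by rewrite index_mem.
have lt_n w : W w -> (index (w a) (root_seq Phi) < n.+1)%N.
  by move=> Ww; rewrite ltnS ltnW // index_mem weyl_group_root.
have := fuv (Ordinal ka); rewrite !ffunE => /(congr1 val) /=.
rewrite (nth_index 0 aR) !inordK ?lt_n //.
by move=> e; rewrite -[LHS](nth_index 0 (weyl_group_root Wu aR)) e nth_index //
  weyl_group_root.
Qed.

Section Parabolic.
Variable J : {set I}.
Local Notation WJ := (par_weyl_group J).

Lemma par_sroot_neq0 a : [set a | exists2 i, i \in J & a = alpha i] a -> a != 0.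
Proof. by move=> [i _ ->]; exact: sroot_neq0. Qed.

Lemma par_weyl_sub : WJ `<=` W.
Proof.
move=> w [s sJ ->]; exists s => // a /sJ[i _ ->]; exact: sroot_root.
Qed.

Lemma finite_par_weyl_group : finite_set WJ.
Proof. exact: sub_finite_set par_weyl_sub finite_weyl_group. Qed.

Lemma par_weyl_coord w j v : WJ w -> j \notin J ->
  root_coord j (w v) = root_coord j v.
Proof.
move=> Ww jJ; elim/reflection_group_ind: w / Ww => [|_ w [i iJ ->] _ IHw].
  by rewrite lfunE.
by rewrite comp_lfunE root_coord_reflection //; apply: contraNneq jJ => <-.
Qed.

Lemma par_weyl_fix w v : WJ w -> (forall i, i \in J -> <[v | alpha i]> = 0) ->
  w v = v.
Proof.
move=> Ww v0; elim/reflection_group_ind: w / Ww => [|_ w [i iJ ->] _ IHw].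
  by rewrite lfunE.
by rewrite comp_lfunE IHw reflectionE v0 // scale0r subr0.
Qed.

(** For a single reflection the difference is minus a simple root; the general
    case follows since weights are stable under reflections. *)
Lemma par_weyl_rho_weight w : WJ w -> wt (w (rho Phi) - rho Phi).
Proof.
move=> Ww; elim/reflection_group_ind: w / Ww => [|_ w [i iJ ->] _ IHw].
  by rewrite lfunE subrr => a _; rewrite pairing0.
rewrite comp_lfunE -{1}(subrK (rho Phi) (w _)) linearD /= sreflection_rho.
rewrite addrA addrAC addrK; apply: weightB (weight_sroot _).
exact: weight_reflection (sroot_root _) IHw.
Qed.

(** Choose in the finite orbit of [v] a vector of largest height, the sum of its
    coordinates on the simple roots: applying the reflection in [alpha i] lowers
    the height by the pairing with [alpha i], which therefore is nonnegative. *)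
Lemma par_weyl_dominant v :
  exists2 w, WJ w & forall i, i \in J -> 0 <= <[w v | alpha i]>.
Proof.
have /finite_seqP[s sW] := finite_par_weyl_group.
pose f (w : 'End(E)) := \sum_(i : I) root_coord i (w v).
have sWP w : WJ w <-> w \in s by rewrite sW.
have /sWP s1 := reflection_group1 sp [set a | exists2 i, i \in J & a = alpha i].
have [w /sWP Ww wmax] := seq_argmax f s1; exists w => // i iJ.
have /sWP/wmax : WJ (s_ (alpha i) \o w)%VF by apply: reflection_groupMl => //;
  exists i.
rewrite /f -subr_ge0 -sumrB (bigD1 i) //= big1 ?addr0.
  by rewrite comp_lfunE reflectionE root_coordB root_coordZ root_coord_sroot
    eqxx mulr1 opprB addrC subrK.
by move=> j ji; rewrite comp_lfunE root_coord_reflection ?subrr // eq_sym.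
Qed.

Definition word (s : seq I) : 'End(E) :=
  \big[@comp_lfun _ _ _ _ / \1%VF]_(i <- s) s_ (alpha i).

Lemma par_weylP w : WJ w <-> exists2 s, {subset s <= J} & w = word s.
Proof.
split=> [Ww|[s sJ ->]].
  elim/reflection_group_ind: w / Ww => [|_ w [i iJ ->] _ [s sJ ->]].
    by exists [::]; rewrite // /word big_nil.
  exists (i :: s); last by rewrite /word big_cons.
  by move=> j; rewrite inE => /orP[/eqP ->|/sJ].
elim: s sJ => [|i s IHs] sJ; first by rewrite /word big_nil;
  exact: reflection_group1.
rewrite /word big_cons; apply: reflection_groupMl.
  by exists i => //; apply: sJ; rewrite mem_head.
by apply: IHs => j js; apply: sJ; rewrite inE js orbT.
Qed.

Lemma word_rcons s i : word (rcons s i) = (word s \o s_ (alpha i))%VF.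
Proof.
elim: s => [|j s IHs]; first by rewrite /word big_cons big_nil comp_lfun1l
  comp_lfun1r.
by rewrite /word rcons_cons !big_cons -!/(word _) IHs comp_lfunA.
Qed.

End Parabolic.

Lemma word_weyl s : W (word s).
Proof.
apply: (@par_weyl_sub [set: I]); apply/par_weylP; exists s => // i;
  by rewrite inE.
Qed.

(** The exchange property. The root [alpha i] becomes negative when the letters
    of [s] are applied one after the other from the right, so at some letter [j]
    a positive root becomes negative. This root is then [alpha j], and
    conjugation shows that deleting this letter has the effect of multiplying by
    the reflection in [alpha i] on the right. *)
Lemma word_exchange s i : - word s (alpha i) \in pos_roots Phi ->
  exists s', [/\ {subset s' <= s}, (size s' < size s)%N
               & (word s \o s_ (alpha i))%VF = word s'].
Proof.
elim: s => [|j t IHt].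
  by rewrite /word big_nil lfunE /= (negPf (pos_rootN (sroot_pos i))).
rewrite /word big_cons comp_lfunE -/(word t) => sneg.
have bR : word t (alpha i) \in root_seq Phi.
  by apply: weyl_group_root (word_weyl t) (sroot_root i).
have [bpos|/IHt[t' [tt' szt' et']]] := pos_rootVopp bR.
  have [bj|bj] := eqVneq (word t (alpha i)) (alpha j); last first.
    by rewrite (negPf (pos_rootN (sreflection_pos bpos bj))) in sneg.
  exists t; split=> //; first by move=> k kt; rewrite inE kt orbT.
  rewrite -comp_lfunA (comp_reflection _ _ (word_weyl t));
    last exact: root_neq0.
  by rewrite bj comp_lfunA reflection_comp_id ?sroot_neq0 // comp_lfun1l.
exists (j :: t'); split => //.
- by move=> k; rewrite !inE => /orP[->//|/tt' ->]; rewrite orbT.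
- by rewrite -comp_lfunA et' /word big_cons.
Qed.

Variable J : {set I}.
Local Notation WJ := (par_weyl_group J).

(** If the last letter of [s] is [i], then [s] cannot map [alpha i] to a
    negative root because [x] and its image are both strictly dominant. The rest
    of the word therefore maps [alpha i] to a negative root, and by the exchange
    property [s] acts as a shorter word. *)
Lemma word_stab_trivial s x : {subset s <= J} ->
  (forall i, i \in J -> 0 < <[x | alpha i]>) ->
  (forall i, i \in J -> 0 < <[word s x | alpha i]>) -> word s = \1%VF.
Proof.
move: {2}(size s).+1 (ltnSn (size s)) => n; elim: n s => // n IHn s.
case: (lastP s) => [|t i] sz sJ x0 sx0; first by rewrite /word big_nil.
have iJ : i \in J by apply: sJ; rewrite mem_rcons mem_head.
have tJ : {subset t <= J} by move=> k kt; apply: sJ;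
  rewrite mem_rcons inE kt orbT.
have Wt : WJ (word t) by apply/par_weylP; exists t.
have bR : word t (alpha i) \in root_seq Phi.
  by apply: weyl_group_root (word_weyl t) (sroot_root i).
have [bpos|/word_exchange[s' [s't szs' es']]] := pos_rootVopp bR; last first.
  rewrite word_rcons es'; apply: IHn => //.
  - by rewrite size_rcons ltnS in sz; apply: leq_trans szs' _; exact: ltnW.
  - by move=> k /s't/tJ.
  - by rewrite -es' -word_rcons.
have : 0 < sp x (alpha i).
  by rewrite sp_pairing ?sroot_neq0 // mulr_gt0 ?x0 // divr_gt0 //
    sp_gt0 ?sroot_neq0.
rewrite -(reflection_group_isometry _ _ _ (word_weyl (rcons t i)));
  last exact: root_neq0.
rewrite [X in sp _ X](_ : _ = - word t (alpha i)); last first.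
  by rewrite word_rcons comp_lfunE reflection_self ?sroot_neq0 // linearN.
rewrite linearNr /= oppr_gt0 ltNge => /negP[].
rewrite [X in sp _ X](root_coordE Phi) linear_sumr sumr_ge0 // => j _;
  rewrite linearZr_LR /=.
have [jJ|jJ] := boolP (j \in J); last first.
  rewrite (par_weyl_coord _ Wt jJ) root_coord_sroot.
  by case: eqVneq iJ jJ => [-> ->//|_ _ _]; rewrite mul0r.
rewrite mulr_ge0 ?pos_root_coord_ge0 // sp_pairing ?sroot_neq0 //.
by apply: mulr_ge0; [exact/ltW/sx0 | rewrite divr_ge0 ?sp_ge0].
Qed.

(** Moving [v] to the other side leaves an element that maps a strictly dominant
    vector to a strictly dominant one, and this element is the identity. *)
Lemma par_weyl_free u v x y : WJ u -> WJ v ->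
  (forall i, i \in J -> 0 < <[x | alpha i]>) ->
  (forall i, i \in J -> 0 < <[y | alpha i]>) -> u x = v y -> u = v /\ x = y.
Proof.
move=> Wu Wv x0 y0 uxvy.
have [v' Wv' [v'v vv']] := reflection_group_inv (@par_sroot_neq0 J) Wv.
have /par_weylP[s sJ es] : WJ (v' \o u)%VF by apply: reflection_groupM.
have v'ux : (v' \o u)%VF x = y by rewrite comp_lfunE uxvy -comp_lfunE v'v lfunE.
have s1 : word s = \1%VF.
  by apply: word_stab_trivial x0 _ => //; rewrite -es v'ux.
rewrite es s1 in v'ux; split; last by rewrite -v'ux lfunE.
by rewrite -[u]comp_lfun1l -vv' -comp_lfunA es s1 comp_lfun1r.
Qed.

End WeylGroups.

(** * Products of geometric series and their symmetries *)

Section FormalSeriesTheory.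
Variables (A : comNzRingType) (E : zmodType).
Implicit Types (f g : E -> A) (a b : E) (c : A) (s : seq E).

Lemma fs_geom_support c a b : fs_geom c a b != 0 -> exists k, b = a *+ k.
Proof. by move=> /fsum_neq0[k /= kb _]; exists k. Qed.

Lemma fs_mul_support f g b : fs_mul f g b != 0 ->
  exists x, f x != 0 /\ g (b - x) != 0.
Proof.
move=> /fsum_neq0[x _ fg]; exists x.
by split; apply: contraNneq fg => ->; rewrite ?mul0r ?mulr0.
Qed.

Lemma fs_geom_prod_support c s (C : E -> Prop) :
  C 0 -> (forall u v, C u -> C v -> C (u + v)) -> (forall a, a \in s -> C a) ->
  forall b, fs_geom_prod c s b != 0 -> C b.
Proof.
move=> C0 CD; rewrite /fs_geom_prod; elim: s => [|a s IHs] Cs b.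
  by rewrite big_nil /fs_one; have [->|_] := eqVneq b 0; rewrite ?eqxx.
rewrite big_cons => /fs_mul_support[x [/fs_geom_support[k ->] /IHs Cbx]].
rewrite -(subrKC (a *+ k) b); apply: (CD).
  elim: k {Cbx} => [|k IHk]; rewrite ?mulr0n // mulrS.
  by apply: CD => //; apply: Cs; rewrite mem_head.
by apply: Cbx => y ys; apply: Cs; rewrite inE ys orbT.
Qed.

(** Coefficients of a product with a geometric series. The bound [n] makes the
    sum finite, which is what the finitely supported sum of [fs_mul] needs in
    order not to collapse to 0. *)
Lemma fs_mul_geomE c a g b n : injective (fun k => a *+ k) ->
  (forall k, (n <= k)%N -> g (b - a *+ k) = 0) ->
  fs_mul (fs_geom c a) g b = \sum_(k < n) c ^+ k * g (b - a *+ k).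
Proof.
move=> a_inj g0; have geomE k : fs_geom c a (a *+ k) = c ^+ k.
  rewrite /fs_geom (_ : [set j | _] = [set k]) ?fsbig_set1 //.
  by apply/seteqP; split=> j /= => [/a_inj|->].
rewrite /fs_mul -(fsbig_widen (range (fun k => a *+ k))) //; last first.
  move=> x [_ /= nx]; apply/eqP; apply: contra_notT nx => gx.
  have [k ->] : exists k, x = a *+ k; last by exists k.
  by apply: (@fs_geom_support c); apply: contraNneq gx => ->; rewrite mul0r.
rewrite fsbig_image; last by move=> i j _ _; exact: a_inj.
rewrite (fsbig_ord _ _ (fun k => c ^+ k * g (b - a *+ k))).
under eq_fsbigr do rewrite geomE.
apply/esym/fsbig_widen => // k [_ /= /negP]; rewrite -leqNgt => nk.
by rewrite g0 ?mulr0.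
Qed.

(** The product of the formal series [f] with 1 - c e^a. It is a finite
    expression for any family [f], and products of geometric series are handled
    below as solutions of equations in these operators. *)
Definition fs_diff c f a : E -> A := fun b => f b - c * f (b - a).

Lemma fs_diffC c f a a' :
  fs_diff c (fs_diff c f a) a' = fs_diff c (fs_diff c f a') a.
Proof. by apply/funext => b; rewrite /fs_diff [b - a - a']addrAC; ring. Qed.

Lemma foldl_fs_diffC c f a s :
  foldl (fs_diff c) (fs_diff c f a) s = fs_diff c (foldl (fs_diff c) f s) a.
Proof. by elim: s f => //= b s IHs f; rewrite fs_diffC IHs. Qed.

Lemma perm_foldl_fs_diff c f s1 s2 : perm_eq s1 s2 ->
  foldl (fs_diff c) f s1 = foldl (fs_diff c) f s2.
Proof.
move=> s12; elim: s1 s2 s12 f => [|a s1 IHs] s2 s12 f.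
  by move: s12; rewrite perm_sym => /perm_nilP ->.
have /path.splitPr s2E : a \in s2 by rewrite -(perm_mem s12) mem_head.
case: s2E s12 => p1 p2.
rewrite perm_sym -(cat1s a p2) perm_catCA cat1s perm_cons perm_sym => s12.
by rewrite /= (IHs _ s12) !foldl_cat /= foldl_fs_diffC.
Qed.

Lemma foldl_fs_diff_comp (sigma : {additive E -> E}) c f s :
  foldl (fs_diff c) (f \o sigma) s = foldl (fs_diff c) f (map sigma s) \o sigma.
Proof.
elim: s f => //= a s IHs f; rewrite -IHs; congr foldl.
by apply/funext => b; rewrite /fs_diff /= raddfB.
Qed.

Section Height.
Variables (R : realType) (ht : {additive E -> R}).

(** On series with such a support the multiplication by 1 - c e^a is injective
    when [a] has positive height, although it is not injective on all
    families. *)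
Definition ht_supported f := forall b, f b != 0 -> 0 <= ht b.

Lemma ht_supported0 f b : ht_supported f -> ht b < 0 -> f b = 0.
Proof. by move=> fs; apply: contraTeq => /fs; rewrite leNgt. Qed.

Lemma ht_supported_diff c f a : 0 < ht a -> ht_supported f ->
  ht_supported (fs_diff c f a).
Proof.
move=> a0 fs b; apply: contraNT; rewrite -ltNge => b0; rewrite /fs_diff.
rewrite !(ht_supported0 fs) ?mulr0 ?subrr // raddfB /=; lra.
Qed.

Lemma ht_supported_geom_prod c s : (forall a, a \in s -> 0 < ht a) ->
  ht_supported (fs_geom_prod c s).
Proof.
move=> s0; apply: fs_geom_prod_support => [|u v|a /s0]; last exact: ltW.
  by rewrite raddf0.
by rewrite raddfD; exact: addr_ge0.
Qed.

Lemma ht_arch a b : 0 < ht a -> exists n, ht b < ht a *+ n.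
Proof.
move=> a0; exists (Num.truncn (ht b / ht a)).+1.
by rewrite -mulr_natl -ltr_pdivrMr // truncnS_gt.
Qed.

(** Multiplication by 1 - c e^a undoes multiplication by its inverse: the two
    geometric sums telescope. *)
Lemma fs_diff_mul_geom c a g : 0 < ht a -> ht_supported g ->
  fs_diff c (fs_mul (fs_geom c a) g) a = g.
Proof.
move=> a0 gs; apply/funext => b; rewrite /fs_diff.
have a_inj : injective (fun k => a *+ k).
  move=> j k /(congr1 ht); rewrite !raddfMn /=.
  exact/mulrIn/lt0r_neq0.
have [n bn] := ht_arch b a0.
have g0 k : (n <= k)%N -> g (b - a *+ k) = 0.
  move=> nk; apply: (ht_supported0 gs); rewrite raddfB raddfMn /= subr_lt0.
  by rewrite (lt_le_trans bn) // ler_pMn2l.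
(* One more term is kept at b than at b - a, so that the sums telescope. *)
rewrite (@fs_mul_geomE _ _ _ b n.+1) // => [|k nk]; last by rewrite g0 // ltnW.
rewrite (@fs_mul_geomE _ _ _ (b - a) n) // => [|k nk]; last first.
  by rewrite -addrA -opprD -mulrS g0 // leqW.
rewrite big_ord_recl expr0 mul1r mulr0n subr0 mulr_sumr -addrA -sumrB big1
  ?addr0 // => k _.
by rewrite lift0 exprS -mulrA -[b - a - _]addrA -opprD -mulrS subrr.
Qed.

(** The coefficient at [b] is determined by the one at [b - a], and after
    finitely many steps the height is negative, where both series vanish. *)
Lemma fs_diff_inj c a f1 f2 : 0 < ht a -> ht_supported f1 -> ht_supported f2 ->
  fs_diff c f1 a = fs_diff c f2 a -> f1 = f2.
Proof.
move=> a0 f1s f2s f12; apply/funext => b; have [n] := ht_arch b a0.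
elim: n b => [|n IHn] b bn.
  by rewrite !ht_supported0 // -(mulr0n (ht a)).
have /(congr1 (fun f => f b)) := f12; rewrite /fs_diff (IHn (b - a));
  first exact: addIr.
by rewrite raddfB /= ltrBlDl -mulrS.
Qed.

Lemma foldl_fs_diff_inj c s f1 f2 : (forall a, a \in s -> 0 < ht a) ->
  ht_supported f1 -> ht_supported f2 ->
  foldl (fs_diff c) f1 s = foldl (fs_diff c) f2 s -> f1 = f2.
Proof.
elim: s f1 f2 => //= a s IHs f1 f2 s0 f1s f2s.
have a0 : 0 < ht a by apply: s0; rewrite mem_head.
have s0' b : b \in s -> 0 < ht b by move=> bs; apply: s0; rewrite inE bs orbT.
move=> /IHs/fs_diff_inj; apply=> //; exact: ht_supported_diff.
Qed.

Lemma foldl_fs_diff_geom_prod c s : (forall a, a \in s -> 0 < ht a) ->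
  foldl (fs_diff c) (fs_geom_prod c s) s = @fs_one A E.
Proof.
rewrite /fs_geom_prod; elim: s => [|a s IHs] s0 /=; first by rewrite big_nil.
have s0' b : b \in s -> 0 < ht b by move=> bs; apply: s0; rewrite inE bs orbT.
rewrite big_cons fs_diff_mul_geom ?IHs //; first by apply: s0; rewrite mem_head.
exact: ht_supported_geom_prod.
Qed.

(** The product of the 1 / (1 - c e^a) is the only series with support in
    nonnegative height that becomes 1 when multiplied by all the factors 1 - c
    e^a. Its transform under an involution that permutes the exponents has the
    same property, since these operators commute. *)
Lemma fs_geom_prod_invariant (sigma : {additive E -> E}) c s :
  involutive sigma -> (forall a, a \in s -> 0 < ht a) ->
  (forall a, a \in s -> sigma a \in s) -> uniq s ->
  forall b, fs_geom_prod c s (sigma b) = fs_geom_prod c s b.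
Proof.
move=> sK s0 ss us b;
suff e : fs_geom_prod c s \o sigma = fs_geom_prod c s by rewrite -[in RHS]e.
apply: (foldl_fs_diff_inj (c := c) s0) => [{}b /= fb||].
- pose C x := 0 <= ht (sigma x).
  rewrite -(sK b); apply: (@fs_geom_prod_support c s C) fb; rewrite /C.
  + by rewrite !raddf0.
  + by move=> u v; rewrite !raddfD; exact: addr_ge0.
  + by move=> a /ss/s0/ltW.
- exact: ht_supported_geom_prod.
have s_perm := perm_map_stable (inv_inj sK) us ss.
rewrite foldl_fs_diff_comp (perm_foldl_fs_diff _ _ s_perm).
rewrite foldl_fs_diff_geom_prod //; apply/funext => x.
by rewrite /= /fs_one -(inj_eq (inv_inj sK)) sK raddf0.
Qed.
End Height.
End FormalSeriesTheory.

(** * The branching formula *)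

Section Branching.
Variables (R : realType) (E : vectType R) (sp : {dot E for idfun}).
Variable Phi : based_root_system sp.
Local Notation s_ := (reflection sp).
Local Notation "<[ v | a ]>" := (coroot_pairing sp v a).
Local Notation I := (simple_index Phi).
Local Notation alpha := (@sroot _ _ _ Phi).
Local Notation W := (weyl_group Phi).
Local Notation wt := (weight_lattice Phi).
Local Notation rho := (rho Phi).

Definition root_height (v : E) : R := \sum_(i : I) root_coord i v.

Lemma root_height_is_zmod_morphism : zmod_morphism root_height.
Proof.
by move=> u v; rewrite -sumrB; apply: eq_bigr => i _; rewrite root_coordB.
Qed.
HB.instance Definition _ :=
  GRing.isZmodMorphism.Build E R root_height root_height_is_zmod_morphism.

Lemma root_height_pos a : a \in pos_roots Phi -> 0 < root_height a.
Proof.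
move=> ap; rewrite lt_def sumr_ge0 ?andbT => [|i _];
  last exact: pos_root_coord_ge0.
apply: contra (root_neq0 (pos_root_root ap)).
rewrite psumr_eq0 => [/allP a0|i _]; last exact: pos_root_coord_ge0.
rewrite (root_coordE Phi a) big1 // => i _.
by rewrite (eqP (a0 i _)) ?scale0r // mem_index_enum.
Qed.

Definition root_cone : set E :=
  [set v | exists c : I -> nat, v = \sum_i alpha i *+ c i].

Lemma root_cone0 : root_cone 0.
Proof. by exists (fun=> 0%N); rewrite big1. Qed.

Lemma root_coneD u v : root_cone u -> root_cone v -> root_cone (u + v).
Proof.
move=> [c ->] [d ->]; exists (fun i => c i + d i)%N.
by rewrite -big_split; apply: eq_bigr => i _; rewrite mulrnDr.
Qed.

Lemma root_cone_weight v : root_cone v -> wt v.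
Proof.
move=> [c ->]; elim/big_ind: _ => [|u {}v|i _]; first by move=> a _;
  rewrite pairing0.
  exact: weightD.
elim: (c i) => [|n IHn]; first by move=> a _; rewrite mulr0n pairing0.
by rewrite mulrS; apply/weightD/IHn/weight_sroot.
Qed.

(** If u - x and x - v have natural coordinates on the simple roots, then those
    of x - v are bounded by the coordinates of u - v. *)
Lemma finite_root_interval u v :
  finite_set [set x | root_cone (u - x) /\ root_cone (x - v)].
Proof.
pose n := (Num.truncn (\sum_(i : I) `|root_coord i (u - v)|)).+1.
pose f (c : {ffun I -> 'I_n}) := v + \sum_i alpha i *+ c i.
apply: (@sub_finite_set _ _ (f @` setT)); last exact/finite_image/finite_finset.
move=> x [[d ud] [c xc]].
have cn i : (c i < n)%N.
  rewrite -(ltr_nat R); apply: le_lt_trans (truncnS_gt _).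
  have -> : (c i)%:R = root_coord i (u - v) - (d i)%:R.
    by rewrite -!(root_coord_nat i) -xc -ud -root_coordB opprB [u - v + _]addrC
      subrKA.
  apply: (@le_trans _ _ `|root_coord i (u - v)|).
    by rewrite (le_trans _ (ler_norm _)) // gerBl.
  by rewrite (bigD1 i) //= lerDl sumr_ge0.
exists [ffun i => Ordinal (cn i)] => //; rewrite /f.
under eq_bigr do rewrite ffunE /=.
by rewrite -xc subrKC.
Qed.

Section Parabolic.
Variable J : {set I}.
Local Notation WJ := (par_weyl_group J).
Local Notation PJ := (par_dominant_weights J).

Section AnyRing.
Variable A : comNzRingType.
Implicit Types p q : A.

Lemma hatP_cone p v : hatP J p v != 0 -> root_cone v.
Proof.
apply: fs_geom_prod_support => [|u1 u2|a]; first exact: root_cone0.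
  exact: root_coneD.
by rewrite mem_filter => /andP[_ /pos_root_sum].
Qed.

Lemma barP_cone q v : barP J q v != 0 -> root_cone v.
Proof.
apply: fs_geom_prod_support => [|u1 u2|a]; first exact: root_cone0.
  exact: root_coneD.
by rewrite mem_filter => /andP[_ /pos_root_sum].
Qed.

Lemma hatP_sreflection p i v : i \in J ->
  hatP J p (s_ (alpha i) v) = hatP J p v.
Proof.
move=> iJ; apply: (fs_geom_prod_invariant (ht := root_height)).
- exact/reflectionK/sroot_neq0.
- by move=> a; rewrite mem_filter => /andP[_ /root_height_pos].
- by move=> a; exact: sreflection_nonpar.
- exact/filter_uniq/pos_roots_uniq.
Qed.

Lemma par_rhoE : par_rho J = rho - diamond_part J rho.
Proof. by rewrite -[X in X - _](bar_diamondD J) addrK. Qed.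

Lemma par_weyl_diamond u v : WJ u -> u (diamond_part J v) = diamond_part J v.
Proof.
by move=> Wu; apply: (par_weyl_fix Wu) => i iJ; exact: pairing_diamond.
Qed.

(** The diamond part of [mu] is fixed by the parabolic Weyl group, so it cancels
    in the argument of the partition function. *)
Lemma Kbar_shift lam mu q :
  Kbar J (lam + diamond_part J mu) mu q = Kbar J lam (bar_part J mu) q.
Proof.
apply: eq_fsbigr => u; rewrite inE => Wu; congr (_ * barP J q _).
rewrite [lam + _ + _]addrAC linearD /= par_weyl_diamond //
  -[X in _ - X - _](bar_diamondD J mu).
by congr (_ - _); rewrite opprD [- bar_part _ _ - _]addrC addrA addrK.
Qed.
End AnyRing.

Definition dot_act (w : 'End(E)) (k : E) : E := w (k + rho) - rho.

Lemma dot_act1 k : dot_act \1%VF k = k.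
Proof. by rewrite /dot_act lfunE /= addrK. Qed.

Lemma dot_actM u w k : dot_act (u \o w)%VF k = dot_act u (dot_act w k).
Proof. by rewrite /dot_act subrK comp_lfunE. Qed.

Lemma weight_dot_act u k : WJ u -> wt k -> wt (dot_act u k).
Proof.
move=> Wu kP; rewrite /dot_act linearD -addrA /=; apply: weightD.
  exact/(weyl_group_weight _ kP)/(par_weyl_sub Wu).
exact: par_weyl_rho_weight Wu.
Qed.

Lemma par_dominant_rho_gt0 lam i : PJ lam -> i \in J ->
  0 < <[lam + rho | alpha i]>.
Proof.
by move=> /par_dominantP[_ lJ] iJ; rewrite pairingD pairing_rho ltr_wpDl ?lJ.
Qed.

Lemma dot_act_inj u v lam lam' : WJ u -> WJ v -> PJ lam -> PJ lam' ->
  dot_act u lam = dot_act v lam' -> lam = lam' /\ u = v.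
Proof.
move=> Wu Wv lamJ lamJ' /addIr uv.
have [i iJ|i iJ|-> /addIr -> //] := par_weyl_free Wu Wv _ _ uv.
  exact: par_dominant_rho_gt0.
exact: par_dominant_rho_gt0.
Qed.

(** The pairing of [k] with a simple coroot is an integer greater than -1,
    because that of rho is 1. *)
Lemma dominant_of_regular k : wt k ->
  (forall i, i \in J -> 0 < <[k + rho | alpha i]>) -> PJ k.
Proof.
move=> kP k0; apply/par_dominantP; split=> // i iJ.
have := k0 i iJ; rewrite pairingD pairing_rho.
have /intrP[m ->] := kP _ (sroot_root i).
by rewrite -[1]/(1%:~R) -intrD ltr0z ler0z gtz0_ge1 lerDr.
Qed.

Variable A : idomainType.
Implicit Types p q : A.

(** By invariance of [hatP] the reflection can be moved from kappa to the Weyl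
    group element of the sum, and reindexing changes every sign. *)
Lemma b_coef_sreflection nu k p i : i \in J ->
  b_coef J nu (dot_act (s_ (alpha i)) k) p = - b_coef J nu k p.
Proof.
move=> iJ; have si2 := reflection_comp_id sp (sroot_neq0 i).
have iR : [set a | a \in root_seq Phi] (alpha i) by exact: sroot_root.
rewrite /b_coef -mulN1r mulr_fsumr.
rewrite (@reindex_fsbig _ _ _ _ _ (comp_lfun (s_ (alpha i))) W W); last first.
  split=> [w Ww|w w' _ _ ww'|w Ww].
  - exact: reflection_groupMl.
  - by rewrite -[w]comp_lfun1l -[w']comp_lfun1l -si2 -!comp_lfunA ww'.
  - exists (s_ (alpha i) \o w)%VF; first exact: reflection_groupMl.
    by rewrite comp_lfunA si2 comp_lfun1l.
apply: eq_fsbigr => w; rewrite inE => Ww.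
rewrite (weyl_signMl (@root_neq0 _ _ _ Phi) A iR Ww).
rewrite mulN1r mulNr; congr (- (_ * _)).
rewrite -[RHS](hatP_sreflection p _ iJ) comp_lfunE; congr hatP.
by rewrite /dot_act opprB addrA addrAC addrK -linearB opprD addrA.
Qed.

Lemma b_coef_dot_act nu k p u : WJ u ->
  b_coef J nu (dot_act u k) p = weyl_sign A u * b_coef J nu k p.
Proof.
move=> Wu; elim/reflection_group_ind: u / Wu => [|_ u [i iJ ->] Wu IHu].
  by rewrite dot_act1 weyl_sign1 mul1r.
rewrite dot_actM b_coef_sreflection //
  IHu (weyl_signMl (@par_sroot_neq0 _ _ _ Phi J) A _ Wu) ?mulNr //.
by exists i.
Qed.

(** The shifted reflection fixes [k], so the coefficient is equal to its
    opposite. *)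
Lemma b_coef_singular nu k p i : (2%:R : A) != 0 -> i \in J ->
  <[k + rho | alpha i]> = 0 -> b_coef J nu k p = 0.
Proof.
move=> A2 iJ k0; have := b_coef_sreflection nu k p iJ.
rewrite /dot_act reflectionE k0 scale0r subr0 addrK => /eqP.
by rewrite -addr_eq0 -mulr2n -mulr_natr mulf_eq0 (negPf A2) orbF => /eqP.
Qed.

Section Fixed.
Variables (nu mu : E) (p q : A).

(** A finite set that contains all the kappa that contribute to the expansion of
    K, used to exchange the summations. *)
Definition branching_support : set E :=
  \bigcup_(w in W) [set k | root_cone (w (nu + rho) - rho - k) /\ root_cone (k
    - mu)].
Local Notation D := branching_support.

Lemma finite_branching_support : finite_set D.
Proof.
by apply: bigcup_finite => [|w _];
  [exact: finite_weyl_group | exact: finite_root_interval].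
Qed.

Lemma branching_supportP w k : W w ->
  hatP J p (w (nu + rho) - k - rho) * barP J q (k - mu) != 0 -> D k.
Proof.
move=> Ww; rewrite mulf_eq0 negb_or => /andP[/hatP_cone hw /barP_cone bk].
by exists w => //; split; rewrite // addrAC.
Qed.

Lemma b_coef_barP_support k : b_coef J nu k p * barP J q (k - mu) != 0 -> D k.
Proof.
rewrite mulr_fsuml => /fsum_neq0[w Ww];
  rewrite -mulrA mulf_eq0 negb_or => /andP[_].
exact: branching_supportP.
Qed.

(** For each [w] the substitution x = w(nu + rho) - kappa - rho turns the
    convolution that defines [partP] into a sum over kappa in which the factor
    [barP] is independent of [w]. *)
Lemma Kpq_b_coef_barP : Kpq J nu mu p q =
  \sum_(k \in [set: E]) b_coef J nu k p * barP J q (k - mu).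
Proof.
have finD := finite_branching_support; have finW := finite_weyl_group Phi.
have inner w : W w -> partP J p q (w (nu + rho) - mu - rho) =
    \sum_(k \in D) hatP J p (w (nu + rho) - k - rho) * barP J q (k - mu).
  move=> Ww; rewrite (fsbig_widen D [set: E]) //; last first.
    by move=> k [_ Dk] /=; apply/eqP; apply: contra_notT Dk;
      exact: branching_supportP.
  rewrite /partP /fs_mul (reindex_fsbigT (fun k => w (nu + rho) - k - rho));
    last first.
    by exists (fun k => w (nu + rho) - k - rho) => k;
      rewrite !opprB addrCA [rho + _]addrC addrK addrC subrK.
  by apply: eq_fsbigr => k _; congr (_ * barP J q _);
    rewrite opprB addrA subrK opprB addrC addrA subrK.
rewrite -(fsbig_widen D [set: E]) //; last first.
  by move=> k [_ Dk] /=; apply/eqP; apply: contra_notT Dk;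
    exact: b_coef_barP_support.
transitivity (\sum_(w \in W) \sum_(k \in D) weyl_sign A w *
    (hatP J p (w (nu + rho) - k - rho) * barP J q (k - mu))).
  by apply: eq_fsbigr => w; rewrite inE => Ww; rewrite inner // mulr_fsumr.
rewrite exchange_fsbig //; apply: eq_fsbigr => k _.
by rewrite mulr_fsuml; apply: eq_fsbigr => w _; rewrite mulrA.
Qed.

(** Skew symmetry absorbs the sign of each term of Kbar into b, and rho may
    replace its J-part in the shift because the difference is fixed by the
    parabolic Weyl group. *)
Lemma b_coef_Kbar lam : b_coef J nu lam p * Kbar J lam mu q =
  \sum_(u \in WJ) b_coef J nu (dot_act u lam) p * barP J q (dot_act u lam - mu).
Proof.
rewrite mulr_fsumr; apply: eq_fsbigr => u; rewrite inE => Wu.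
rewrite b_coef_dot_act // mulrCA mulrA; congr (_ * barP J q _).
rewrite /dot_act par_rhoE addrA linearB /= par_weyl_diamond //.
by rewrite opprB addrA [_ - mu + _]addrAC subrK addrAC.
Qed.

Local Notation H lam := (b_coef J nu lam p * Kbar J lam mu q).

Lemma b_coef_Kbar_orbit lam : H lam != 0 -> exists2 u, WJ u & D (dot_act u lam).
Proof.
rewrite b_coef_Kbar => /fsum_neq0[u Wu ulam]; exists u => //.
exact: b_coef_barP_support ulam.
Qed.

(** Here the dominant weights are restricted to finitely many, so that the
    double sum over them and the parabolic Weyl group can be regrouped. *)
Definition branching_weights : set E :=
  [set lam | PJ lam /\ exists2 u, WJ u & D (dot_act u lam)].
Local Notation L := branching_weights.

Lemma finite_branching_weights : finite_set L.
Proof.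
pose f ku := dot_act ku.2 ku.1.
apply: (@sub_finite_set _ _ (f @` (D `*` WJ))); last first.
  apply/finite_image/finite_setX; first exact: finite_branching_support.
  exact: finite_par_weyl_group.
move=> lam [_ [u Wu Du]].
have [u' Wu' [u'u _]] := reflection_group_inv (@par_sroot_neq0 _ _ _ Phi J) Wu.
exists (dot_act u lam, u') => //; rewrite /f /=.
by rewrite -dot_actM u'u dot_act1.
Qed.

Lemma finite_branching_terms : finite_set (PJ `&` [set lam | H lam != 0]).
Proof.
apply: sub_finite_set finite_branching_weights => lam [lamJ /b_coef_Kbar_orbit].
by split.
Qed.

Hypothesis A2 : (2%:R : A) != 0.
Hypothesis mu_wt : wt mu.

(** Move kappa + rho to the dominant chamber of the parabolic Weyl group; by
    skew symmetry it cannot reach a wall, so the shifted orbit of kappa contains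
    a dominant weight. *)
Lemma branching_term_orbit k : b_coef J nu k p * barP J q (k - mu) != 0 ->
  exists2 lam, PJ lam & exists2 u, WJ u & k = dot_act u lam.
Proof.
rewrite mulf_eq0 negb_or => /andP[bk /barP_cone/root_cone_weight kmu].
have kP : wt k by rewrite -(subrK mu k); apply: weightD.
have [w Ww wk] := par_weyl_dominant J (k + rho).
have [u Wu [uw _]] := reflection_group_inv (@par_sroot_neq0 _ _ _ Phi J) Ww.
have kE : k = dot_act u (dot_act w k) by rewrite -dot_actM uw dot_act1.
exists (dot_act w k); last by exists u.
apply: dominant_of_regular => [|i iJ]; first exact: weight_dot_act.
rewrite /dot_act subrK lt_def wk // andbT.
apply: contraNneq bk => wk0; rewrite kE b_coef_dot_act //.
by rewrite (b_coef_singular _ _ A2 iJ) ?mulr0 // subrK.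
Qed.

(** The shifted action embeds the pairs of a dominant weight and an element of
    the parabolic Weyl group into the weights, and its image contains every
    kappa with a nonzero contribution. *)
Lemma Kpq_par_dominant_sum : Kpq J nu mu p q = \sum_(lam \in PJ) H lam.
Proof.
have finWJ := finite_par_weyl_group J.
rewrite -(fsbig_widen L PJ) => [|lam []//|lam [lamJ Llam]]; last first.
  by apply/eqP; apply: contra_notT Llam => /b_coef_Kbar_orbit.
under eq_fsbigr do rewrite b_coef_Kbar.
rewrite pair_fsbig //; last exact: finite_branching_weights.
pose h (lu : E * 'End(E)) := dot_act lu.2 lu.1.
pose G k := b_coef J nu k p * barP J q (k - mu).
rewrite -(@fsbig_image _ _ _ _ _ _ h G); last first.
  move=> [lam u] [lam' u']; rewrite !inE => -[[lamJ _] Wu] [[lamJ' _] Wu'].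
  by move=> /(dot_act_inj Wu Wu' lamJ lamJ')[/= -> ->].
rewrite Kpq_b_coef_barP; apply/esym/fsbig_widen => // k [_ hk] /=.
apply/eqP; apply: contra_notT hk => Gk.
have [lam lamJ [u Wu kE]] := branching_term_orbit Gk.
exists (lam, u) => //; split=> //=; split=> //; exists u => //.
by rewrite -kE; apply: b_coef_barP_support Gk.
Qed.

End Fixed.
End Parabolic.
End Branching.

Unset Implicit Arguments.

Theorem theorem3p1 (R : realType)
    (g : lieAlgebra R[i]) (h : {vspace g})
    (g_simple : lie_simple g) (h_cartan : cartan_subalgebra h)
    (E : vectType R) (sp : {dot E for idfun}) (Phi : based_root_system sp)
    (Phi_gh : is_root_system_of Phi h)
    (J : {set simple_index Phi}) (nu mu : E)
    (nu_dom : dominant_weights Phi nu) (mu_wt : weight_lattice Phi mu) :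
  let Pbar := par_dominant_weights J in
  let mubar := bar_part J mu in
  let mudia := diamond_part J mu in
  let F1 lam := b_coef J nu (lam + mudia) p_ind * Kbar J lam mubar q_ind in
  let F2 lam := b_coef J nu (lam + mudia) p_ind * Kbar J (lam + mudia) mu q_ind in
  [/\ finite_set (Pbar `&` [set lam | F1 lam != 0]),
      finite_set (Pbar `&` [set lam | F2 lam != 0]),
      Kpq J nu mu p_ind q_ind = \sum_(lam \in Pbar) F1 lam,
      \sum_(lam \in Pbar) F1 lam = \sum_(lam \in Pbar) F2 lam
    & forall lam, Pbar lam -> Pbar (lam + mudia)].
Proof.
move=> Pbar mubar mudia F1 F2.
have -> : F1 = F2 by apply/funext => lam; rewrite /F1 /F2 Kbar_shift.
pose H lam := b_coef J nu lam p_ind * Kbar J lam mu q_ind.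
have PbarD lam : Pbar lam -> Pbar (lam + mudia) by exact: par_dominant_diamond.
have PbarB lam : Pbar lam -> Pbar (lam - mudia).
  have -> : - mudia = diamond_part J (- mu) by rewrite /diamond_part linearN.
  exact/par_dominant_diamond/weightN.
have finF2 : finite_set (Pbar `&` [set lam | F2 lam != 0]).
  apply: (@sub_finite_set _ _ ((fun lam => lam - mudia) @`
    (Pbar `&` [set lam | H lam != 0]))).
    move=> lam [lamP F2lam]; exists (lam + mudia); last by rewrite addrK.
    by split; [exact: PbarD | exact: F2lam].
  exact/finite_image/finite_branching_terms.
have two_neq0 : 2%:R != 0 :> {poly {poly int}}.
  have -> : 2%:R = (2%:R : int)%:P%:P :> {poly {poly int}}.
    by rewrite !rmorph_nat.
  by rewrite !polyC_eq0.
split=> //; rewrite Kpq_par_dominant_sum //.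
rewrite (@reindex_fsbig _ _ _ _ _ (fun lam => lam + mudia) Pbar Pbar) //.
split=> [lam /PbarD //|lam lam' _ _ /addIr //|lam /PbarB lamP].
by exists (lam - mudia); rewrite ?subrK.
Qed.
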